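(* A (finite, simple) graph $G$ is a mixed unit interval graph if and only if $G$ has a $\mathcal{U}$-bubble model. Moreover, given a mixed unit interval representation of a graph $G$ on $n$ vertices, a $\mathcal{U}$-bubble model of $G$ can be constructed in $O(n)$ time.
   Context: Unit intervals: for $x\in\mathbb{R}$, the closed interval $[x,x+1]$, open $(x,x+1)$, closed-open $[x,x+1)$ and open-closed $(x,x+1]$ have types $(+,+)$, $(-,-)$, $(+,-)$, $(-,+)$ respectively. A graph is a mixed unit interval graph if it is the intersection graph of a family of unit intervals of arbitrary (possibly mixed) types; such a family (one interval per vertex, $uv\in E$ iff the intervals intersect) is a mixed unit interval representation. A 2-dimensional $\mathcal{U}$-bubble structure for a finite nonempty set $A$ is a family $\mathcal{B}=\langle B_{i,j}\rangle_{1\le j\le k,\,1\le i\le r_j}$ of pairwise disjoint (possibly empty) sets (''bubbles'') with union $A$, where each bubble is partitioned into four (possibly empty) quadrants $B_{i,j}=B^{++}_{i,j}\cup B^{+-}_{i,j}\cup B^{-+}_{i,j}\cup B^{--}_{i,j}$. Write $B^{*+}_{i,j}=B^{++}_{i,j}\cup B^{-+}_{i,j}$ and $B^{+*}_{i,j}=B^{++}_{i,j}\cup B^{+-}_{i,j}$. Bubbles with the same $j$ form column $j$; bubbles with the same $i$ form row $i$. The graph $G(\mathcal{B})$ has vertex set $A$, and distinct $u,v$ are adjacent iff, for some ordering of $u,v$, $u\in B_{i,j}$, $v\in B_{i',j'}$ and one of: (a) $j=j'$; (b) $j=j'-1$ and $i>i'$; (c) $j=j'-1$, $i=i'$, $u\in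 B^{*+}_{i,j}$ and $v\in B^{+*}_{i',j'}$. A $\mathcal{U}$-bubble model of a graph $G$ is a $\mathcal{U}$-bubble structure $\mathcal{B}$ for $V(G)$ such that (i) $G$ is isomorphic to $G(\mathcal{B})$; (ii) each column and each row contains a nonempty bubble; (iii) no column ends with an empty bubble (i.e. $B_{r_j,j}\neq\emptyset$); (iv) letting $\mathrm{top}(j)=\min\{i: B_{i,j}\neq\emptyset\}$, we have $\mathrm{top}(1)=1$ and $\mathrm{top}(j)\le\mathrm{top}(j+1)$ for all $1\le j\le k-1$.
   Formalization: The O(n) construction is stated for a representation whose intervals are listed by nondecreasing left endpoint; for an arbitrarily ordered list no linear bound holds on a real RAM with additions and comparisons, since testing whether G is edgeless already needs Ω(n log n) time. *)

(* Defs.v *)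
From HB Require Import structures.
From mathcomp Require Import all_boot all_order all_algebra.
From mathcomp Require Import boolp classical_sets set_interval reals.
Set Implicit Arguments.
Unset Strict Implicit.
Unset Printing Implicit Defensive.
Import Order.TTheory GRing.Theory Num.Theory.

(* The type of an interval, or of a quadrant: [true] is [+] (closed end),
   [false] is [-] (open end); the left end comes first. *)
Definition itype : Type := (bool * bool)%type.

Definition unit_interval (R : realType) (x : R) (q : itype) : set R :=
  match q with
  | (true, true) => [set` `[x, (x + 1)%R]]
  | (false, false) => [set` `]x, (x + 1)%R[]
  | (true, false) => [set` `[x, (x + 1)%R[]
  | (false, true) => [set` `]x, (x + 1)%R]]
  end%classic.

Definition simple_graph (V : finType) (e : rel V) : Prop :=
  symmetric e /\ irreflexive e.

(* Vertex [v] is represented by the interval of type [q v] that starts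
   at [x v]. *)
Definition mui_representation (R : realType) (V : finType) (e : rel V)
    (x : V -> R) (q : V -> itype) : Prop :=
  forall u v : V, u != v ->
    (e u v <->
     (unit_interval (x u) (q u) `&` unit_interval (x v) (q v) !=set0)%classic).

Definition mixed_unit_interval_graph (R : realType) (V : finType) (e : rel V)
  : Prop :=
  exists (x : V -> R) (q : V -> itype), mui_representation e x q.

Section Bubbles.
Variable A : finType.

(* Columns [j] and rows [i] are numbered from 1, and [quad i j q] is the
   quadrant of type [q] of the bubble in row [i] of column [j]. The values of
   [rows] and [quad] outside of the index range are irrelevant. *)
Definition in_range (cols : nat) (rows : nat -> nat) (i j : nat) : bool :=
  (1 <= j <= cols) && (1 <= i <= rows j).

Definition bubble_of (quad : nat -> nat -> itype -> {set A}) (i j : nat)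
  : {set A} :=
  quad i j (true, true) :|: quad i j (true, false)
  :|: quad i j (false, true) :|: quad i j (false, false).

Record bubble_structure := BubbleStructure {
  cols : nat;
  rows : nat -> nat;
  quad : nat -> nat -> itype -> {set A};
  bubbles_cover : forall v : A,
    exists i j, in_range cols rows i j /\ v \in bubble_of quad i j;
  bubbles_disjoint : forall i j i' j',
    in_range cols rows i j -> in_range cols rows i' j' ->
    (i, j) != (i', j') ->
    [disjoint bubble_of quad i j & bubble_of quad i' j'];
  quads_disjoint : forall i j (q q' : itype),
    in_range cols rows i j -> q != q' ->
    [disjoint quad i j q & quad i j q']
}.

Variable B : bubble_structure.

Definition has_bubble (i j : nat) : bool := in_range (cols B) (rows B) i j.

Definition bubble (i j : nat) : {set A} := bubble_of (quad B) i j.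

Definition right_closed_part (i j : nat) : {set A} :=
  quad B i j (true, true) :|: quad B i j (false, true).

Definition left_closed_part (i j : nat) : {set A} :=
  quad B i j (true, true) :|: quad B i j (true, false).

Definition bubble_arc (u v : A) : Prop :=
  exists i j i' j',
    [/\ has_bubble i j, has_bubble i' j', u \in bubble i j, v \in bubble i' j' &
     [\/ j = j',
         j.+1 = j' /\ i' < i |
         [/\ j.+1 = j', i = i', u \in right_closed_part i j
           & v \in left_closed_part i' j']]].

Definition bubble_adj (u v : A) : Prop :=
  u <> v /\ (bubble_arc u v \/ bubble_arc v u).

(* The value is [(rows B j).+1] if column [j] has no nonempty bubble. *)
Definition top (j : nat) : nat :=
  (find (fun i => bubble i j != finset.set0) (iota 1 (rows B j))).+1.

End Bubbles.

Definition bubble_model (V : finType) (e : rel V) (B : bubble_structure V)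
  : Prop :=
  [/\ exists f : V -> V, bijective f /\
        (forall u v, e u v <-> bubble_adj B (f u) (f v)),
      (forall j, 1 <= j <= cols B ->
        exists i, has_bubble B i j /\ bubble B i j != finset.set0) /\
      (forall i, (exists j, has_bubble B i j) ->
        exists j, has_bubble B i j /\ bubble B i j != finset.set0),
      forall j, 1 <= j <= cols B -> bubble B (rows B j) j != finset.set0 &
      top B 1 = 1 /\
      (forall j, 1 <= j -> j.+1 <= cols B -> top B j <= top B j.+1)].

(* Running time is measured on a real RAM: a program is a structured command
   over a memory made of unbounded arrays of naturals and of unbounded arrays
   of exact reals, numbered by naturals and all cells of which are directly
   accessible (a register is cell 0 of an array). Every node of an evaluated
   expression and every executed command costs one time unit.

   The reals only have the constant 1, addition, subtraction and exact
   comparison: there is no multiplication and no rounding. The naturals only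
   have constants, successor, predecessor and comparison, so that a run of
   length t on n intervals only produces naturals bounded by n + t plus a
   constant, and the unit cost of an access is the usual one. *)
Inductive nexp :=
| NConst of nat
| NCell of nat & nexp
| NSucc of nexp
| NPred of nexp.

Inductive rexp :=
| ROne
| RCell of nat & nexp
| RAdd of rexp & rexp
| RSub of rexp & rexp.

Inductive bexp :=
| BNlt of nexp & nexp
| BNeq of nexp & nexp
| BRlt of rexp & rexp
| BReq of rexp & rexp
| BNot of bexp
| BAnd of bexp & bexp.

Inductive cmd :=
| Skip
| NSet of nat & nexp & nexp
| RSet of nat & nexp & rexp
| Seq of cmd & cmd
| If of bexp & cmd & cmd
| While of bexp & cmd.

Fixpoint nsize (a : nexp) : nat :=
  match a with
  | NConst _ => 1
  | NCell _ i => (nsize i).+1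
  | NSucc a | NPred a => (nsize a).+1
  end.

Fixpoint rsize (a : rexp) : nat :=
  match a with
  | ROne => 1
  | RCell _ i => (nsize i).+1
  | RAdd a b | RSub a b => (rsize a + rsize b).+1
  end.

Fixpoint bsize (a : bexp) : nat :=
  match a with
  | BNlt a b | BNeq a b => (nsize a + nsize b).+1
  | BRlt a b | BReq a b => (rsize a + rsize b).+1
  | BNot a => (bsize a).+1
  | BAnd a b => (bsize a + bsize b).+1
  end.

Section Semantics.
Variable R : realType.

Record state := State {
  nmem : nat -> nat -> nat;
  rmem : nat -> nat -> R
}.

Definition upd (T : Type) (m : nat -> nat -> T) (a i : nat) (x : T)
  : nat -> nat -> T :=
  fun a' i' => if (a' == a) && (i' == i) then x else m a' i'.

Fixpoint neval (s : state) (a : nexp) : nat :=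
  match a with
  | NConst c => c
  | NCell m i => nmem s m (neval s i)
  | NSucc a => (neval s a).+1
  | NPred a => (neval s a).-1
  end.

Fixpoint reval (s : state) (a : rexp) : R :=
  match a with
  | ROne => 1%R
  | RCell m i => rmem s m (neval s i)
  | RAdd a b => (reval s a + reval s b)%R
  | RSub a b => (reval s a - reval s b)%R
  end.

Fixpoint beval (s : state) (a : bexp) : bool :=
  match a with
  | BNlt a b => neval s a < neval s b
  | BNeq a b => neval s a == neval s b
  | BRlt a b => (reval s a < reval s b)%R
  | BReq a b => (reval s a == reval s b)%R
  | BNot a => ~~ beval s a
  | BAnd a b => beval s a && beval s b
  end.

(* [exec p s t s']: started in [s], the program [p] halts in [s'] after [t]
   time units. *)
Inductive exec : cmd -> state -> nat -> state -> Prop :=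
| exec_skip s : exec Skip s 1 s
| exec_nset m i a s :
    exec (NSet m i a) s (nsize i + nsize a).+1
         (State (upd (nmem s) m (neval s i) (neval s a)) (rmem s))
| exec_rset m i a s :
    exec (RSet m i a) s (nsize i + rsize a).+1
         (State (nmem s) (upd (rmem s) m (neval s i) (reval s a)))
| exec_seq p1 p2 s s1 s2 t1 t2 :
    exec p1 s t1 s1 -> exec p2 s1 t2 s2 ->
    exec (Seq p1 p2) s (t1 + t2).+1 s2
| exec_if b p1 p2 s s' t :
    exec (if beval s b then p1 else p2) s t s' ->
    exec (If b p1 p2) s (bsize b + t).+1 s'
| exec_while_end b p s :
    ~~ beval s b -> exec (While b p) s (bsize b).+1 s
| exec_while_loop b p s s1 s2 t1 t2 :
    beval s b -> exec p s t1 s1 -> exec (While b p) s1 t2 s2 ->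
    exec (While b p) s (bsize b + t1 + t2).+1 s2.

Lemma exec_deterministic p s t1 s1 t2 s2 :
  exec p s t1 s1 -> exec p s t2 s2 -> t1 = t2 /\ s1 = s2.
Proof.
move=> E1; elim: E1 t2 s2 => {p s t1 s1}.
- by move=> s t2 s2 E2; inversion E2.
- by move=> m i a s t2 s2 E2; inversion E2.
- by move=> m i a s t2 s2 E2; inversion E2.
- move=> p1 p2 s s1 s2 t1 t2 _ IH1 _ IH2 t s' E2.
  inversion E2 as [| | |? ? ? ? ? ? ? F1 F2| | |]; subst.
  by have [? ?] := IH1 _ _ F1; subst; have [-> ->] := IH2 _ _ F2.
- move=> b p1 p2 s s' t _ IH t2 s2 E2.
  inversion E2 as [| | | |? ? ? ? ? ? F| |]; subst.
  by have [-> ->] := IH _ _ F.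
- move=> b p s nb t2 s2 E2.
  by inversion E2 as [| | | | | |? ? ? ? ? ? ? bs]; subst; rewrite ?bs in nb *.
- move=> b p s s1 s2 t1 t2 bs _ IH1 _ IH2 t s' E2.
  inversion E2 as [| | | | |? ? ? nb|? ? ? ? ? ? ? _ F1 F2]; subst.
    by rewrite bs in nb.
  by have [? ?] := IH1 _ _ F1; subst; have [-> ->] := IH2 _ _ F2.
Qed.

(* Input format, for a representation whose intervals are listed in the order
   [vs]: the number of intervals is in natural array 0 (cell 0), the left
   endpoints are in real array 0, and the left and right signs (1 for [+],
   0 for [-]) are in natural arrays 1 and 2. All other cells hold 0. *)
Definition input_state (V : finType) (vs : seq V) (x : V -> R)
    (q : V -> itype) : state :=
  State
    (fun a i =>
       match a with
       | 0 => if i == 0 then size vs else 0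
       | 1 => nth 0 [seq nat_of_bool (q v).1 | v <- vs] i
       | 2 => nth 0 [seq nat_of_bool (q v).2 | v <- vs] i
       | _ => 0
       end)
    (fun a i => if a == 0 then nth 0%R [seq x v | v <- vs] i else 0%R).

(* Output format. A bubble structure may have quadratically many empty
   bubbles, so it is output as the number of columns (natural array 3,
   cell 0), the number of rows of every column (natural array 4) and, for
   every vertex, the row, the column and the two signs of the quadrant it
   belongs to (natural arrays 5, 6, 7 and 8, at the position of the vertex in
   the input). *)
Definition outputs (V : finType) (vs : seq V) (s : state)
    (B : bubble_structure V) : Prop :=
  [/\ nmem s 3 0 = cols B,
      forall j, 1 <= j <= cols B -> nmem s 4 j = rows B j &
      forall (v : V) i j (q : itype), has_bubble B i j -> v \in quad B i j q ->
        [/\ nmem s 5 (index v vs) = i, nmem s 6 (index v vs) = j,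
            nmem s 7 (index v vs) = q.1 & nmem s 8 (index v vs) = q.2]].

(* A representation is given to a program as the list of its intervals from
   left to right. On an arbitrarily ordered list no linear bound can hold with
   these operations: for closed intervals starting at even integers, the number
   of columns of a bubble model decides whether the integers are distinct. *)
Definition left_endpoint_order (V : finType) (x : V -> R) (vs : seq V)
  : Prop :=
  perm_eq vs (enum V) /\ sorted (fun u v => (x u <= x v)%R) vs.

End Semantics.

(* Main.v *)
Require Import Defs.
From HB Require Import structures.
From mathcomp Require Import all_boot all_order all_algebra.
From mathcomp Require Import boolp classical_sets set_interval reals.
From mathcomp Require Import zify lra.
Set Implicit Arguments.
Unset Strict Implicit.
Unset Printing Implicit Defensive.
Import Order.TTheory GRing.Theory Num.Theory.

(** From a model, put the vertices of the bubble [(i, j)] at [j + i / N] with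
    [N] larger than every row number.

    From a representation sorted by left endpoints, open a new column whenever
    an interval starts at distance at least 1 from the start of the current
    column. Let the height of an interval be its left endpoint minus its column
    number. Intervals of one column meet, intervals two columns apart do not,
    and intervals of consecutive columns meet according to the comparison of
    their heights. So the rows only have to order heights correctly within
    pairs of consecutive columns. This is weaker than sorting all heights, and
    is achieved in linear time by keeping the rows in a linked list: each new
    interval joins, or is inserted immediately after, the row of the highest
    interval below it in its own column and the previous one, which is found by
    a pointer that only moves forward. *)

(** * Columns *)

Lemma unit_intervalE (R : realType) (x z : R) (q : itype) :
  unit_interval x q z =
  ((if q.1 then x <= z else x < z) && (if q.2 then z <= x + 1 else z < x + 1))%R
  :> Prop.
Proof. by case: q => [[] []]; rewrite /unit_interval /mkset in_setE in_itv. Qed.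

Lemma unit_interval_meet (R : realType) (x x' : R) (q q' : itype) :
  (x <= x')%R ->
  (unit_interval x q `&` unit_interval x' q' !=set0)%classic <->
  ((x' < x + 1)%R \/ [/\ x' = (x + 1)%R, q.2 & q'.1]).
Proof.
move=> lexx'; split.
  case=> z []; rewrite !unit_intervalE.
  case: q q' => [[] []] [[] []] /= /andP[h1 h2] /andP[h3 h4];
    by [left; lra | have [->|ne] := eqVneq x' (x + 1)%R;
        [right | left; rewrite lt_neqAle ne; lra]].
case=> [lt|[E q2 q1]].
  (* The midpoint of [x'] and [x + 1] is interior to both intervals, whatever their types. *)
  exists ((x' + x + 1) / 2)%R; split; rewrite unit_intervalE.
    by case: q => [[] []] /=; apply/andP; split; lra.
  by case: q' => [[] []] /=; apply/andP; split; lra.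
exists x'; split; rewrite unit_intervalE.
  by case: q q2 => [[] []] //= _; apply/andP; split; lra.
by case: q' q1 => [[] []] //= _; apply/andP; split; lra.
Qed.

Section Columns.
Variables (R : realType) (n : nat) (x : nat -> R).
Hypothesis x_sorted : forall i j, i <= j -> j < n -> (x i <= x j)%R.

Fixpoint col_start (i : nat) : nat :=
  if i is i'.+1 then
    if (x i < x (col_start i') + 1)%R then col_start i' else i
  else 0.

Fixpoint column (i : nat) : nat :=
  if i is i'.+1 then
    if (x i < x (col_start i') + 1)%R then column i' else (column i').+1
  else 1.

Definition height (i : nat) : R := (x i - (column i)%:R)%R.

Lemma col_gt0 i : 0 < column i.
Proof. by elim: i => //= i IH; case: ifP. Qed.

Lemma col_start_le i : col_start i <= i.
Proof. by elim: i => //= i IH; case: ifP => // _; apply: leqW. Qed.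

Lemma col_col_start i : column (col_start i) = column i.
Proof. by elim: i => //= i IH; case: ifP => //= ->. Qed.

Lemma col_mono i j : i <= j -> column i <= column j.
Proof.
move/subnK <-; elim: (j - i) => // d IH; rewrite addSn /=.
by case: ifP => _; rewrite // (leq_trans IH).
Qed.

Lemma col_surj m j : 0 < j <= column m -> exists2 u, u <= m & column u = j.
Proof.
elim: m => [|m IH] /=; first by exists 0 => //=; lia.
move=> jm; have [jle|jgt] := leqP j (column m).
  by have [|u um uj] := IH; [lia|exists u => //; apply: leqW].
by exists m.+1 => //=; move: jm; case: ifP => _; lia.
Qed.

Lemma height_start_le i : i < n -> (height (col_start i) <= height i)%R.
Proof.
move=> lt_in; rewrite /height col_col_start.
by have := x_sorted (col_start_le i) lt_in; lra.
Qed.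

Lemma height_lt_start i : (height i < height (col_start i) + 1)%R.
Proof.
rewrite /height col_col_start; case: i => [|i] /=; first by lra.
by case: ifP => h; lra.
Qed.

(** A column opens at distance at least 1 from the previous start while the column number grows by
    1, so the height of the start cannot drop. *)
Lemma height_start_mono i j : i <= j ->
  (height (col_start i) <= height (col_start j))%R.
Proof.
move/subnK <-; elim: (j - i) => [|d IH] //; apply: le_trans IH _.
rewrite /height !col_col_start addSn /=; case: ifP => [_|h]; first by lra.
rewrite -natr1; lra.
Qed.

(** Both heights lie in the half-open unit interval that begins at the height of the common
    start. *)
Lemma same_col_close u w : u < n -> w < n -> column u = column w ->
  (x w < x u + 1)%R.
Proof.
move=> un wn E.
wlog uw : u w un wn E / u <= w => [H|].
  case: (leqP u w) => [|/ltnW wu]; first exact: H.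
  by have := x_sorted wu un; lra.
have Hs : col_start u = col_start w.
  move: E uw; clear; move/[swap]/subnK => <-.
  elim: (w - u) => [|d IH] //; rewrite addSn /=; case: ifP => // _ E.
  by have := @col_mono u (d + u) (leq_addl _ _); lia.
have := height_lt_start w; have := height_start_le un.
by rewrite -Hs /height E; lra.
Qed.

(** [height w] is at least the height of the start of [u], hence exceeds [height u - 1]; a
    difference of two or more columns then leaves a distance above 1. *)
Lemma far_cols u w : u < n -> w < n -> (column u).+1 < column w ->
  (x u + 1 < x w)%R.
Proof.
move=> un wn lt_c; have uw : u <= w.
  by rewrite leqNgt; apply/negP => /ltnW/col_mono; lia.
have := height_start_mono uw; have := height_lt_start u.
have := height_start_le wn; rewrite /height !col_col_start.
have : ((column u).+2%:R <= (column w)%:R :> R)%R by rewrite ler_nat.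
by rewrite -!natr1; lra.
Qed.

Lemma col_lt u w : u < n -> w < n -> column u < column w -> (x u < x w)%R.
Proof.
move=> un wn lt_c; have uw : u <= w.
  by rewrite leqNgt; apply/negP => /ltnW/col_mono; lia.
have := height_start_mono uw; have := height_lt_start u.
have := height_start_le wn; rewrite /height !col_col_start.
have : ((column u).+1%:R <= (column w)%:R :> R)%R by rewrite ler_nat.
by rewrite -!natr1; lra.
Qed.

(** The witness is the start of the previous column. It serves to locate the column of the
    predecessor of [m]. *)
Lemma prev_col_start m : m < n -> 1 < column m ->
  exists z, [/\ z < m, (column z).+1 = column m & (x z + 1 <= x m)%R].
Proof.
move=> mn c1; have [|u um uc] := @col_surj m (column m).-1; first by lia.
exists (col_start u); have lt_um : u < m.
  by move: um; rewrite leq_eqVlt; case: eqP uc => [->|]; lia.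
split; first exact: leq_ltn_trans (col_start_le u) lt_um.
  by rewrite col_col_start; lia.
have := height_start_mono um; have := height_start_le mn.
have : (column u).+1 = column m by lia.
by rewrite /height !col_col_start => <-; rewrite -natr1; lra.
Qed.

(** * Predecessors in height *)

Definition near_cols (u w : nat) :=
  (column u <= (column w).+1) && (column w <= (column u).+1).

(** The last clause says that no earlier interval near [m] is higher than [p] without being higher
    than [m]. As an equality of booleans it lets [m] inherit comparisons from [p]. *)
Definition height_pred (m p : nat) : Prop :=
  [/\ p < m, column m = column p \/ column m = (column p).+1,
     (height p <= height m)%R &
     forall w, w < m -> near_cols w m ->
       (height w <= height m)%R = (height w <= height p)%R].

(* [a] counts the intervals that end at or before the start of [m]: the
   predecessor is the last of them if it does not already end at or before the
   start of [m.-1], and [m.-1] otherwise. *)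
Lemma height_predP m a p :
  0 < m < n -> a <= m -> p < m ->
  (forall w, w < a -> (x w + 1 <= x m)%R) -> (x m < x a + 1)%R ->
  (p.+1 = a /\ (x m.-1 < x p + 1)%R) \/
  (p = m.-1 /\ forall w, w < a -> (x w + 1 <= x m.-1)%R) ->
  height_pred m p.
Proof.
move=> /andP[m0 mn] am pm Ha ltxa Hp.
have an : a < n by lia.
have Hw w : w < m -> (x w + 1 <= x m)%R -> w < a.
  move=> wm h; rewrite ltnNge; apply/negP => aw.
  by have := @x_sorted a w aw (ltn_trans wm mn); lra.
case: Hp => [[pa ltm]|[pE Hlow]].
  have Hpm : (x p + 1 <= x m)%R by apply: Ha; lia.
  have cpm : column p < column m.
    rewrite ltn_neqAle (col_mono (ltnW pm)) andbT; apply/eqP => E.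
    by have := same_col_close (ltn_trans pm mn) mn E; lra.
  (* The start [z] of the column before that of [m] is among the first [a] intervals, so [p], the
     last of these, is not before [z] and lies in the same column. *)
  have [|z [zm zc zx]] := prev_col_start mn; first by have := col_gt0 p; lia.
  have za := Hw _ zm zx.
  have cE : column m = (column p).+1.
    have : column z <= column p by apply: col_mono; lia.
    by lia.
  split=> //; first by right.
    by rewrite /height cE -natr1; lra.
  (* In the column of [m] both sides are true; in that of [p] both say that [w] is among the first
     [a] intervals. *)
  move=> w wm /andP[c1 c2]; have := col_mono (ltnW wm) => c3.
  have [cw|cw] : column w = column m \/ (column w).+1 = column m by lia.
    have xwm : (x w <= x m)%R by exact: x_sorted (ltnW wm) mn.
    have xw1 : (x w <= x m.-1)%R by apply: x_sorted; lia.
    by rewrite /height cw cE -natr1; apply/idP/idP; lra.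
  have {}cw : column w = column p by lia.
  rewrite /height cw cE -natr1.
  apply/idP/idP => h; last by lra.
  have wa : w < a by apply: Hw => //; lra.
  have : (x w <= x p)%R by apply: x_sorted; lia.
  lra.
have m1n : m.-1 < n by lia.
have cE : column m = column p.
  apply/eqP; rewrite eqn_leq (col_mono (ltnW pm)) andbT leqNgt.
  (* Otherwise [m] opens a column, and by [Hlow] the start [z] of the column of [m.-1] is at
     distance at least 1 from [m.-1], which is impossible within a column. *)
  apply/negP => lt_c.
  have [|z [zm zc zx]] := prev_col_start mn; first by have := col_gt0 p; lia.
  have za := Hw _ zm zx.
  have : column m <= (column p).+1.
    by rewrite pE -{1}(prednK m0) /=; case: ifP => _; lia.
  move=> le_c; have E : column z = column m.-1 by rewrite -pE; lia.
  by have := same_col_close (ltn_trans zm mn) m1n E; have := Hlow _ za; lra.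
have xpm : (x p <= x m)%R by exact: x_sorted (ltnW pm) mn.
split=> //; first by left.
  by rewrite /height cE; lra.
move=> w wm /andP[c1 c2]; have := col_mono (ltnW wm) => c3.
have [cw|cw] : column w = column m \/ (column w).+1 = column m by lia.
  have xwm : (x w <= x m)%R by exact: x_sorted (ltnW wm) mn.
  have xw1 : (x w <= x p)%R by rewrite pE; apply: x_sorted; lia.
  by rewrite /height cw cE; apply/idP/idP; lra.
have E : (height m - height p = x m - x p)%R by rewrite /height cE; lra.
apply/idP/idP => h; last by lra.
(* An interval of the previous column at most as high as [m] ends by the left end of [m], hence, by
   [Hlow], by that of [p]. *)
have wa : w < a.
  apply: Hw => //; move: h; rewrite /height -cw -natr1; lra.
by have := Hlow _ wa; rewrite -pE /height -cE -cw -natr1; lra.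
Qed.

End Columns.

(** * Bubble models *)

Section BubbleFacts.
Variable V : finType.

Lemma in_bubble_of (quad : nat -> nat -> itype -> {set V}) i j v :
  v \in bubble_of quad i j -> exists q, v \in quad i j q.
Proof.
by rewrite !inE => /orP[/orP[/orP[]|]|] h; eexists; exact: h.
Qed.

Lemma quad_sub_bubble (B : bubble_structure V) i j q v :
  v \in quad B i j q -> v \in bubble B i j.
Proof. by case: q => [[] []] h; rewrite !inE h ?orbT. Qed.

Lemma bubble_unique (B : bubble_structure V) i j i' j' v :
  has_bubble B i j -> has_bubble B i' j' ->
  v \in bubble B i j -> v \in bubble B i' j' -> i = i' /\ j = j'.
Proof.
move=> h h' vB vB'; case: (eqVneq (i, j) (i', j')) => [[-> ->] //|ne].
have /pred0P/(_ v) /= := bubbles_disjoint h h' ne.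
by rewrite vB vB'.
Qed.

Lemma quad_unique (B : bubble_structure V) i j q q' v :
  has_bubble B i j -> v \in quad B i j q -> v \in quad B i j q' -> q = q'.
Proof.
move=> h vq vq'; apply/eqP/negP => /negP ne.
have /pred0P/(_ v) /= := quads_disjoint h ne.
by rewrite vq vq'.
Qed.

Lemma right_closedE (B : bubble_structure V) i j q v :
  has_bubble B i j -> v \in quad B i j q ->
  (v \in right_closed_part B i j) = q.2.
Proof.
move=> h vq; apply/idP/idP => [|q2].
  by rewrite inE => /orP[] /(quad_unique h vq) ->.
by case: q vq q2 => [[] []] //= vq _; rewrite inE vq ?orbT.
Qed.

Lemma left_closedE (B : bubble_structure V) i j q v :
  has_bubble B i j -> v \in quad B i j q ->
  (v \in left_closed_part B i j) = q.1.
Proof.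
move=> h vq; apply/idP/idP => [|q1].
  by rewrite inE => /orP[] /(quad_unique h vq) ->.
by case: q vq q1 => [[] []] //= vq _; rewrite inE vq ?orbT.
Qed.

Section Located.
Variables (B : bubble_structure V) (r c : V -> nat) (q : V -> itype).
Hypothesis loc : forall v,
  has_bubble B (r v) (c v) /\ v \in quad B (r v) (c v) (q v).

Lemma bubble_arcE u v :
  bubble_arc B u v <->
  [\/ c u = c v, (c u).+1 = c v /\ r v < r u |
      [/\ (c u).+1 = c v, r u = r v, (q u).2 & (q v).1]].
Proof.
have [hu qu] := loc u; have [hv qv] := loc v.
split=> [[i [j [i' [j' [h h' ub vb]]]]]|H].
  have [-> ->] := bubble_unique h hu ub (quad_sub_bubble qu).
  have [-> ->] := bubble_unique h' hv vb (quad_sub_bubble qv).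
  by rewrite (right_closedE hu qu) (left_closedE hv qv).
exists (r u), (c u), (r v), (c v).
rewrite (right_closedE hu qu) (left_closedE hv qv).
by split=> //; [exact: quad_sub_bubble qu|exact: quad_sub_bubble qv].
Qed.

(** Shared by both directions: [z] is a position computed from the bubbles in one and the given left
    endpoint in the other. The hypotheses make rows compare positions in consecutive columns after a
    shift by 1. *)
Lemma bubble_adj_meet (R : realType) (z : V -> R) u v :
  (forall u v, c u < c v -> (z u < z v)%R) ->
  (forall u v, c u = c v -> (z v < z u + 1)%R) ->
  (forall u v, c v = (c u).+1 -> (z v < z u + 1)%R = (r v < r u)) ->
  (forall u v, c v = (c u).+1 -> (z v == z u + 1)%R = (r v == r u)) ->
  (forall u v, (c u).+1 < c v -> (z u + 1 < z v)%R) ->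
  u <> v ->
  (bubble_adj B u v <->
   (unit_interval (z u) (q u) `&` unit_interval (z v) (q v) !=set0)%classic).
Proof.
move=> z_mono z_same z_lt z_eq z_far.
wlog le_z : u v / (z u <= z v)%R => [H|] ne.
  case: (leP (z u) (z v)) => [|/ltW le]; first by move/H; exact.
  rewrite setIC -H //; last by move=> E; apply: ne.
  by rewrite /bubble_adj; split=> -[? ?]; split; by [apply: nesym|apply/or_comm].
have le_c : c u <= c v.
  by rewrite leqNgt; apply/negP => /z_mono; rewrite ltNge le_z.
rewrite (unit_interval_meet _ _ le_z) /bubble_adj !bubble_arcE; split.
  case=> _ [] [].
  - by move/z_same; left.
  - by case=> cE lt; left; rewrite z_lt.
  - by case=> cE rE q2 q1; right; split=> //; apply/eqP; rewrite z_eq // rE.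
  - by move/esym/z_same; left.
  - by case; lia.
  - by case; lia.
case=> [lt|[zE q2 q1]]; split=> //; left.
  have [cE|ne_c] := eqVneq (c u) (c v); first by apply: Or31.
  have cE : c v = (c u).+1.
    apply/eqP; rewrite eq_sym eqn_leq [X in X && _]ltn_neqAle ne_c le_c /= leqNgt.
    by apply/negP => /z_far; lra.
  by apply: Or32; rewrite -z_lt.
have ne_c : c u != c v by apply/eqP => /z_same; lra.
have cE : c v = (c u).+1.
  apply/eqP; rewrite eq_sym eqn_leq [X in X && _]ltn_neqAle ne_c le_c /= leqNgt.
  by apply/negP => /z_far; lra.
by apply: Or33; split=> //; apply/esym/eqP; rewrite -z_eq // zE.
Qed.

End Located.

Lemma located (B : bubble_structure V) :
  exists (r c : V -> nat) (q : V -> itype),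
    forall v, has_bubble B (r v) (c v) /\ v \in quad B (r v) (c v) (q v).
Proof.
have H (v : V) : exists z : nat * nat * itype,
    has_bubble B z.1.1 z.1.2 /\ v \in quad B z.1.1 z.1.2 z.2.
  have [i [j [h vb]]] := bubbles_cover B v.
  by have [q vq] := in_bubble_of vb; exists (i, j, q).
have [z Hz] := boolp.choice H.
by exists (fun v => (z v).1.1), (fun v => (z v).1.2), (fun v => (z v).2).
Qed.

End BubbleFacts.

(** * From a model to a representation *)

Lemma bubble_model_mixed_unit_interval (R : realType) (V : finType) (e : rel V)
    (B : bubble_structure V) :
  bubble_model e B -> mixed_unit_interval_graph R e.
Proof.
case=> [[f [bij_f adj]] _ _ _]; have inj_f := bij_inj bij_f.
have [r [c [q loc]]] := located B.
(* With this [N] the offset of a row stays below 1 and does not reach the next column. *)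
pose N := (\max_v r v).+1.
have N0 : (0 < N%:R :> R)%R by rewrite ltr0n.
have frac v : (0 <= (r v)%:R / N%:R :> R)%R /\ ((r v)%:R / N%:R < 1 :> R)%R.
  split; first by rewrite divr_ge0 ?ler0n.
  by rewrite ltr_pdivrMr // mul1r ltr_nat ltnS leq_bigmax.
pose z v : R := ((c v)%:R + (r v)%:R / N%:R)%R.
exists (fun v => z (f v)), (fun v => q (f v)) => u v ne_uv.
rewrite adj; apply: (bubble_adj_meet loc); last first.
- by move=> /inj_f E; rewrite E eqxx in ne_uv.
- move=> {ne_uv} {}u {}v lt.
  have : ((c u).+2%:R <= (c v)%:R :> R)%R by rewrite ler_nat.
  by have [? ?] := frac u; have [? ?] := frac v; rewrite -!natr1 /z; lra.
- move=> {ne_uv} {}u {}v cE; rewrite /z cE -natr1 -(eqr_nat R).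
  have Ni : (N%:R^-1 != 0 :> R)%R by rewrite invr_eq0 lt0r_neq0.
  rewrite -[RHS](inj_eq (mulIf Ni)).
  by apply/idP/idP => /eqP h; apply/eqP; lra.
- move=> {ne_uv} {}u {}v cE; rewrite /z cE -natr1 -(ltr_nat R).
  rewrite -[RHS](ltr_pM2r (x := N%:R^-1)%R) ?invr_gt0 //.
  by apply/idP/idP; lra.
- by move=> {ne_uv} {}u {}v cE; have [? ?] := frac u;
  have [? ?] := frac v; rewrite /z cE; lra.
move=> {ne_uv} {}u {}v lt.
have : ((c u).+1%:R <= (c v)%:R :> R)%R by rewrite ler_nat.
by have [? ?] := frac u; have [? ?] := frac v; rewrite -natr1 /z; lra.
Qed.

(** * From a numbering of rows to a model *)

(* Vertex [v] is the interval number [index v vs]; [row] and [last_row] only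
   matter below [size vs], resp. on the columns in use. *)
Section Model.
Variables (R : realType) (V : finType) (e : rel V) (x : V -> R)
  (q : V -> itype) (vs : seq V).
Hypotheses (e_simple : simple_graph e) (V_gt0 : 0 < #|V|).
Hypothesis rep : mui_representation e x q.
Hypothesis vs_order : left_endpoint_order x vs.

Let X (i : nat) : R := nth 0%R [seq x v | v <- vs] i.
Let n := size vs.

Lemma order_size : size vs = #|V|.
Proof. by case: vs_order => /perm_size -> _; rewrite cardE. Qed.

Lemma order_mem v : v \in vs.
Proof. by case: vs_order => /perm_mem -> _; rewrite mem_enum. Qed.

Lemma order_uniq : uniq vs.
Proof. by case: vs_order => /perm_uniq -> _; exact: enum_uniq. Qed.

Lemma order_sorted i j : i <= j -> j < n -> (X i <= X j)%R.
Proof.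
move=> ij jn; case: vs_order => _ srt.
have srt' : sorted (fun a b : R => (a <= b)%R) [seq x v | v <- vs].
  by rewrite sorted_map.
apply: (sorted_leq_nth _ _ 0%R srt') => //; rewrite ?inE ?size_map //.
- exact: le_trans.
- exact: leq_ltn_trans ij jn.
Qed.

Lemma order_index_lt v : index v vs < n.
Proof. by rewrite index_mem order_mem. Qed.

Lemma order_nth v : X (index v vs) = x v.
Proof. by rewrite /X (nth_map v) ?order_index_lt // nth_index ?order_mem. Qed.

(** The hypotheses isolate what the program has to compute: rows that agree with heights in near
    columns and leave no gap, and for each column its last occupied row. *)
Variables (row last_row : nat -> nat).
Hypothesis row_order : forall u w, u < n -> w < n -> near_cols X u w ->
  (row u <= row w) = (height X u <= height X w)%R.
Hypothesis row0 : row 0 = 1.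
Hypothesis row_gt0 : forall u, u < n -> 0 < row u.
Hypothesis row_surj : forall u i, u < n -> 0 < i <= row u ->
  exists2 w, w < n & row w = i.
Hypothesis row_last : forall u, u < n ->
  row u <= last_row (column X u) /\
  exists w, [/\ w < n, column X w = column X u & last_row (column X u) = row w].

Let r v := row (index v vs).
Let c v := column X (index v vs).
Let cols0 := column X n.-1.
Let quad0 i j (p : itype) := [set v | [&& r v == i, c v == j & q v == p]].

Let in_quad0 i j p v :
  (v \in quad0 i j p) = [&& r v == i, c v == j & q v == p].
Proof. by rewrite inE. Qed.

Let in_bubble0 i j v : (v \in bubble_of quad0 i j) = (r v == i) && (c v == j).
Proof.
rewrite !inE; case: (q v) => [[] []]; case: (r v == i) (c v == j) => [] [] //.
Qed.

Let n_gt0 : 0 < n. Proof. by rewrite /n order_size. Qed.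

Let range0 v : in_range cols0 last_row (r v) (c v).
Proof.
have vn := order_index_lt v; have [le_r _] := row_last vn.
rewrite /in_range col_gt0 row_gt0 // le_r !andbT col_mono //.
by rewrite -ltnS prednK.
Qed.

Let cover0 v : exists i j,
  in_range cols0 last_row i j /\ v \in bubble_of quad0 i j.
Proof. by exists (r v), (c v); rewrite range0 in_bubble0 !eqxx. Qed.

Let disjoint0 i j i' j' :
  in_range cols0 last_row i j -> in_range cols0 last_row i' j' ->
  (i, j) != (i', j') -> [disjoint bubble_of quad0 i j & bubble_of quad0 i' j'].
Proof.
move=> _ _ ne; apply/pred0P => v /=; rewrite !in_bubble0.
apply/negP => /andP[/andP[/eqP E1 /eqP E2] /andP[/eqP E3 /eqP E4]].
by rewrite -E1 -E2 E3 E4 eqxx in ne.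
Qed.

Let qdisjoint0 i j (p p' : itype) : in_range cols0 last_row i j -> p != p' ->
  [disjoint quad0 i j p & quad0 i j p'].
Proof.
move=> _ ne; apply/pred0P => v /=; rewrite !in_quad0.
apply/negP => /andP[/and3P[_ _ /eqP E1] /and3P[_ _ /eqP E2]].
by rewrite -E1 E2 eqxx in ne.
Qed.

Definition order_bubbles : bubble_structure V :=
  BubbleStructure cover0 disjoint0 qdisjoint0.

Let B := order_bubbles.

Let vertex_of u : u < n -> exists v, index v vs = u.
Proof.
move=> un; have v0 : V by move: V_gt0 => /card_gt0P/sigW[].
by exists (nth v0 vs u); rewrite index_uniq // order_uniq.
Qed.

Let in_bubble i j v : (v \in bubble B i j) = (r v == i) && (c v == j).
Proof. exact: in_bubble0. Qed.

Let col_vertex j : 0 < j <= cols0 -> exists v, c v = j.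
Proof.
move=> jc; have [u un uj] := col_surj jc.
by have [|v vE] := @vertex_of u; [lia|exists v; rewrite /c vE].
Qed.

Let row_height u w : c u <= (c w).+1 -> c w <= (c u).+1 ->
  (r u <= r w) = (height X (index u vs) <= height X (index w vs))%R.
Proof. by move=> h1 h2; rewrite row_order ?order_index_lt // /near_cols h1. Qed.

Lemma order_bubbles_located v :
  has_bubble B (r v) (c v) /\ v \in quad B (r v) (c v) (q v).
Proof. by split; [exact: range0|rewrite in_quad0 !eqxx]. Qed.

Let X_sorted := order_sorted.

(** In consecutive columns, comparing [x v] with [x u + 1] amounts to comparing heights, which the
    rows do. *)
Lemma order_bubbles_adj u v : e u v <-> bubble_adj B u v.
Proof.
have [<-|ne] := eqVneq u v.
  by case: e_simple => _ ->; split=> // -[].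
rewrite rep // (bubble_adj_meet (z := x) order_bubbles_located) //.
all: try (move=> {ne} {}u {}v; have un := order_index_lt u;
  have vn := order_index_lt v; rewrite -!order_nth).
- exact: (col_lt X_sorted un vn).
- exact: (same_col_close X_sorted un vn).
- move=> cE; rewrite ltnNge row_height ?cE; [|lia..].
  rewrite -ltNge /height -!/(c _) cE -natr1.
  by apply/idP/idP; lra.
- move=> cE; rewrite eqn_leq !row_height ?cE; [|lia..].
  rewrite -eq_le /height -!/(c _) cE -natr1.
  by apply/idP/idP => /eqP h; apply/eqP; lra.
- exact: (far_cols X_sorted un vn).
by move=> E; rewrite E eqxx in ne.
Qed.

Lemma order_bubbles_model : bubble_model e B.
Proof.
(* The top of an occupied column is attained by a vertex and is minimal there; the shifts by one
   below come from numbering rows from 1. *)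
have topP j v : c v = j -> exists2 w, c w = j & top B j = r w /\ r w <= r v.
  move=> vj; rewrite /top.
  pose P i := bubble B i j != finset.set0; pose s := iota 1 (rows B j).
  rewrite -/P -/s.
  have rv_s : r v \in s.
    by rewrite mem_iota; have := range0 v; rewrite vj /in_range /=; lia.
  have Prv : P (r v).
    by apply/set0Pn; exists v; rewrite in_bubble vj !eqxx.
  have hs : has P s by apply/hasP; exists (r v).
  have lt_f : find P s < rows B j by rewrite -[rows B j](size_iota 1) -has_find.
  have := nth_find 0 hs; rewrite nth_iota // add1n => /set0Pn[w].
  rewrite in_bubble => /andP[/eqP wr /eqP wc]; exists w => //; split=> //.
  rewrite wr ltnNge; apply/negP => lt.
  have lt' : (r v).-1 < find P s by move: rv_s lt; rewrite mem_iota; lia.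
  have := before_find 0 lt'; rewrite nth_iota; last first.
    by move: rv_s; rewrite mem_iota; lia.
  by rewrite add1n prednK ?Prv //; move: rv_s; rewrite mem_iota => /andP[].
split.
- by exists id; split; [exists id|exact: order_bubbles_adj].
- split=> [j /col_vertex[v vj]|i [j /andP[/= jc /andP[i0 ir]]]].
    exists (r v); rewrite -vj; split; first exact: range0.
    by apply/set0Pn; exists v; rewrite in_bubble !eqxx.
  have [v vj] := col_vertex jc.
  have [_ [w [wn _ lE]]] := row_last (order_index_lt v).
  (* Row [i] is not below the last row, that of [w], so it has an occupant, possibly in another
     column. *)
  have [|w' w'n w'r] := @row_surj w i wn; first by rewrite -lE -/(c v) vj i0.
  have [v' v'E] := vertex_of w'n.
  have rE : r v' = i by rewrite /r v'E.
  exists (c v'); rewrite -rE; split; first exact: range0.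
  by apply/set0Pn; exists v'; rewrite in_bubble !eqxx.
- move=> j /col_vertex[v vj].
  have [_ [w [wn wc lE]]] := row_last (order_index_lt v).
  have [v' v'E] := vertex_of wn.
  apply/set0Pn; exists v'; rewrite in_bubble /= -vj lE /r /c v'E wc.
  by rewrite !eqxx.
split.
  (* Interval 0 lies in column 1 and row 1, which forces the top to be 1. *)
  have [v vE] := vertex_of n_gt0.
  have [|w _ [-> le]] := topP 1 v; first by rewrite /c vE.
  by have /andP[_ /andP[/= gt _]] := range0 w; move: le gt; rewrite /r vE row0; lia.
move=> j j1 jc.
have [|v vj] := @col_vertex j.+1; first by rewrite jc.
have [w wj [-> _]] := topP _ _ vj.
have [|u uj] := @col_vertex j; first by rewrite j1 ltnW.
(* The row of the start [u'] of column [j] bounds [top B j]. Its height is at most that of the next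
   start, hence that of [w], which attains the top of column [j.+1]. *)
have [|u' u'E] := @vertex_of (col_start X (index u vs)).
  exact: leq_ltn_trans (col_start_le _ _) (order_index_lt u).
have u'j : c u' = j by rewrite /c u'E col_col_start.
have [t _ [-> le]] := topP _ _ u'j; apply: leq_trans le _.
rewrite row_height ?u'j ?wj ?u'E; [|lia..].
have uw : index u vs <= index w vs.
  by rewrite leqNgt; apply/negP => /ltnW/(col_mono X); rewrite -!/(c _) uj wj ltnn.
apply: le_trans (height_start_mono X uw) _.
exact: height_start_le (order_index_lt w).
Qed.

End Model.

(** * The program *)

Section Execution.
Variable R : realType.

Fixpoint loop_free (p : cmd) : bool :=
  match p with
  | Seq p1 p2 | If _ p1 p2 => loop_free p1 && loop_free p2
  | While _ _ => false
  | _ => true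
  end.

(* Junk value [s] on loops. *)
Fixpoint run (p : cmd) (s : state R) : state R :=
  match p with
  | Skip | While _ _ => s
  | NSet m i a => State (upd (nmem s) m (neval s i) (neval s a)) (rmem s)
  | RSet m i a => State (nmem s) (upd (rmem s) m (neval s i) (reval s a))
  | Seq p1 p2 => run p2 (run p1 s)
  | If b p1 p2 => if beval s b then run p1 s else run p2 s
  end.

(** Counting both branches of a conditional gives a time bound independent of the state for
    loop-free commands. For a loop with loop-free body it bounds one pass, guard included. *)
Fixpoint csize (p : cmd) : nat :=
  match p with
  | Skip => 1
  | NSet m i a => (nsize i + nsize a).+1
  | RSet m i a => (nsize i + rsize a).+1
  | Seq p1 p2 => (csize p1 + csize p2).+1
  | If b p1 p2 => (bsize b + (csize p1 + csize p2)).+1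
  | While b p => (bsize b + csize p).+1
  end.

Lemma exec_run p s : loop_free p ->
  exists2 t, t <= csize p & exec p s t (run p s).
Proof.
elim: p s => [|m i a|m i a|p1 IH1 p2 IH2|b p1 IH1 p2 IH2|//] s /=.
- by exists 1 => //; constructor.
- by move=> _; eexists; last by constructor.
- by move=> _; eexists; last by constructor.
- case/andP=> l1 l2; have [t1 le1 e1] := IH1 s l1.
  have [t2 le2 e2] := IH2 (run p1 s) l2.
  exists (t1 + t2).+1; first by rewrite ltnS leq_add.
  exact: exec_seq e1 e2.
- case/andP=> l1 l2; have [t1 le1 e1] := IH1 s l1.
  have [t2 le2 e2] := IH2 s l2.
  case: ifP => bs; [exists (bsize b + t1).+1 | exists (bsize b + t2).+1].
  + by rewrite ltnS leq_add2l (leq_trans le1) ?leq_addr.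
  + by apply: exec_if; rewrite bs.
  + by rewrite ltnS leq_add2l (leq_trans le2) ?leq_addl.
  + by apply: exec_if; rewrite bs.
Qed.

(** Total correctness with invariant [Inv] and variant [mu]; the extra 1 in the bound pays for the
    final test of the guard. *)
Lemma exec_while (Inv : state R -> Prop) (mu : state R -> nat) b p s :
  loop_free p ->
  (forall s, Inv s -> beval s b -> Inv (run p s) /\ mu (run p s) < mu s) ->
  Inv s ->
  exists t s', [/\ exec (While b p) s t s', Inv s', ~~ beval s' b &
    t <= (mu s).+1 * csize (While b p)].
Proof.
move=> lf step; have [k] := ubnP (mu s); elim: k s => // k IH s le_k inv_s.
have [bs|nbs] := boolP (beval s b); last first.
  exists (bsize b).+1, s; split=> //; first exact: exec_while_end.
  by rewrite mulSn (leq_trans _ (leq_addr _ _)) //= ltnS leq_addr.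
have [inv1 lt1] := step s inv_s bs.
have [t1 le1 e1] := exec_run s lf.
have [|t2 [s2 [e2 inv2 nb2 le2]]] := IH (run p s) _ inv1; first by lia.
exists (bsize b + t1 + t2).+1, s2; split=> //.
  exact: exec_while_loop e1 e2.
rewrite mulSn; have : (mu (run p s)).+1 * csize (While b p) <=
    mu s * csize (While b p).
  by rewrite leq_mul2r lt1 orbT.
move/(leq_trans le2) => {}le2; rewrite -addSn; apply: leq_add le2.
by rewrite /= ltnS leq_add2l.
Qed.

End Execution.

(** * Insertion of the intervals from left to right *)

(* Register 0 of natural array 9 is the interval [i] being inserted, register
   1 is the number [a] of intervals known to end at or before its left end,
   and register 2 its predecessor [p]. Array 10 maps an interval to the list
   cell of its row, array 11 holds the successors in that list, the end of
   which is marked by 0, and array 12 the row numbers of its cells. Numbering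
   the rows reuses registers 0 and 1 for the current cell and its row. *)
Definition reg k := NCell 9 (NConst k).
Definition xof i := RCell 0 i.

(** Interval 0 is already in place: its list cell, the end mark, [a] and [p] are all 0 in the
    initial memory. Real array 1 holds the left endpoint of the start of the current column. *)
Definition init_prog : cmd :=
  Seq (NSet 9 (NConst 0) (NConst 1))
  (Seq (NSet 3 (NConst 0) (NConst 1))
  (Seq (NSet 6 (NConst 0) (NConst 1))
       (RSet 1 (NConst 0) (xof (NConst 0))))).

Definition advance_prog : cmd :=
  Seq (NSet 9 (NConst 2) (reg 1)) (NSet 9 (NConst 1) (NSucc (reg 1))).

Definition column_prog : cmd :=
  Seq (If (BRlt (xof (reg 0)) (RAdd (RCell 1 (NConst 0)) ROne)) Skip
        (Seq (RSet 1 (NConst 0) (xof (reg 0)))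
             (NSet 3 (NConst 0) (NSucc (NCell 3 (NConst 0))))))
      (NSet 6 (reg 0) (NCell 3 (NConst 0))).

(** A disjunction by De Morgan: heights agree when left endpoints are equal, in one column, or
    differ by 1, in consecutive columns. No height is ever computed. *)
Definition same_height : bexp :=
  BNot (BAnd (BNot (BReq (xof (reg 2)) (xof (reg 0))))
             (BNot (BReq (RAdd (xof (reg 2)) ROne) (xof (reg 0))))).

Definition link_prog : cmd :=
  If same_height
    (NSet 10 (reg 0) (NCell 10 (reg 2)))
    (Seq (NSet 11 (reg 0) (NCell 11 (NCell 10 (reg 2))))
    (Seq (NSet 11 (NCell 10 (reg 2)) (reg 0))
         (NSet 10 (reg 0) (reg 0)))).

Definition next_prog : cmd :=
  Seq (NSet 9 (NConst 2) (reg 0)) (NSet 9 (NConst 0) (NSucc (reg 0))).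

(** A merge of left ends with right ends, right ends first in a tie; register 2 keeps the interval
    of the latest event. *)
Definition insert_body : cmd :=
  If (BRlt (xof (reg 0)) (RAdd (xof (reg 1)) ROne))
    (Seq column_prog (Seq link_prog next_prog))
    advance_prog.

Definition insert_guard : bexp := BNlt (reg 0) (NCell 0 (NConst 0)).

(** * The linked list of rows *)

Section Linked.
Variables (R : realType) (x : nat -> R).

(* The list has [len] cells, the cell at position [k] is [at_ k], and [pos u]
   is the position of the cell [node u] of interval [u]. *)
Record linked (m len : nat) (pos at_ node next : nat -> nat) : Prop := Linked {
  linked_len : 0 < len <= m;
  linked_head : at_ 0 = 0;
  linked_at : forall k, k < len -> at_ k < m /\ pos (at_ k) = k;
  linked_next : forall k, k < len ->
    next (at_ k) = if k.+1 < len then at_ k.+1 else 0;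
  linked_pos : forall u, u < m -> pos u < len;
  linked_node : forall u, u < m -> node u = at_ (pos u);
  linked_order : forall u w, u < m -> w < m -> near_cols x u w ->
    (pos u <= pos w) = (height x u <= height x w)%R
}.

Lemma linked_pos0 m len pos at_ node next :
  linked m len pos at_ node next -> pos 0 = 0.
Proof. by case=> /andP[l0 _] h H _ _ _ _; have [_] := H 0 l0; rewrite h. Qed.

Lemma linked_ext m len pos at_ node next node' next' :
  linked m len pos at_ node next ->
  (forall u, u < m -> node' u = node u) -> next' =1 next ->
  linked m len pos at_ node' next'.
Proof.
case=> ll hd at_P nx ps nd od E1 E2; split=> // [k kl|u um].
  by rewrite E2 nx.
by rewrite E1 ?nd.
Qed.

Lemma linked1 : linked 1 1 (fun=> 0) (fun=> 0) (fun=> 0) (fun=> 0).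
Proof.
split=> // [k|u w]; first by case: k.
by case: u => // _; case: w => // _ _; rewrite leqnn lexx.
Qed.

(** Cell 0 is the head and never a successor, so the end mark 0 is unambiguous. *)
Lemma linked_at_eq0 m len pos at_ node next k :
  linked m len pos at_ node next -> k < len -> (at_ k == 0) = (k == 0).
Proof.
move=> lk kl; have [_ posE] := linked_at lk kl.
apply/eqP/eqP => [h|->]; last exact: linked_head lk.
by rewrite -posE h (linked_pos0 lk).
Qed.

(** At equal heights, [m] inherits from [p] every comparison with an interval near [m]. *)
Lemma linked_share m p len pos at_ node next :
  linked m len pos at_ node next -> height_pred x m p ->
  height x p = height x m ->
  linked m.+1 len [eta pos with m |-> pos p] at_
    [eta node with m |-> node p] next.
Proof.
move=> lk [pm cpm _ hw] E; have [/andP[l0 lm] hd at_P nx ps nd od] := lk.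
have ltm u : u < m.+1 -> u != m -> u < m by lia.
(* Both [p] and any earlier interval near [m] lie in the column of [m] or in the one before. *)
have near_p w : w < m -> near_cols x w m -> near_cols x w p /\ near_cols x p w.
  move=> wm; have := col_mono x (ltnW wm); rewrite /near_cols => c1 /andP[c2 c3].
  by case: cpm => c4; lia.
have hle w : w < m -> near_cols x w m ->
    (height x m <= height x w)%R = (pos p <= pos w).
  by move=> wm nr; have [n1 n2] := near_p _ wm nr; rewrite od // E.
split=> //=; first by lia.
- move=> k kl; have [atm posat] := at_P k kl.
  by rewrite ltn_eqF // ltnW.
- by move=> u um; case: eqP => [_|/eqP ne]; apply: ps => //; exact: ltm.
- by move=> u um; case: eqP => [_|/eqP ne]; apply: nd => //; exact: ltm.
move=> u w um wm; case: (eqVneq u m) => [->|nu]; case: (eqVneq w m) => [->|nw] nr.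
- by rewrite leqnn lexx.
- by rewrite hle // ?ltm //; move: nr; rewrite /near_cols andbC.
- have um' := ltm _ um nu; have [nr1 _] := near_p u um' nr.
  by rewrite (hw u um' nr) (od u p um' pm nr1).
- by rewrite od ?ltm.
Qed.

(** The new cell is at position [(pos p).+1] and later positions shift by one. Near intervals up to
    the position of [p] are strictly lower than [m], those after it strictly higher. *)
Lemma linked_insert m p len pos at_ node next :
  linked m len pos at_ node next -> height_pred x m p ->
  (height x p < height x m)%R ->
  linked m.+1 len.+1
    (fun u => if u == m then (pos p).+1
              else if pos u <= pos p then pos u else (pos u).+1)
    (fun k => if k <= pos p then at_ k
              else if k == (pos p).+1 then m else at_ k.-1)
    [eta node with m |-> m]
    (fun u => if u == node p then m
              else if u == m then next (node p) else next u).
Proof.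
move=> lk [pm cpm _ hw] E; have [/andP[l0 lm] hd at_P nx ps nd od] := lk.
have ltm u : u < m.+1 -> u != m -> u < m by lia.
have near_p w : w < m -> near_cols x w m -> near_cols x w p.
  move=> wm; have := col_mono x (ltnW wm); rewrite /near_cols => c1 /andP[c2 c3].
  by case: cpm => c4; lia.
have pl := ps p pm; have ndp := nd p pm.
have at_inj k k' : k < len -> k' < len -> (at_ k == at_ k') = (k == k').
  move=> kl kl'; apply/eqP/eqP => [h|-> //].
  by have [_ <-] := at_P k kl; rewrite h; have [_ ->] := at_P k' kl'.
have at_m k : k < len -> (at_ k == m) = false.
  by move=> kl; have [h _] := at_P k kl; rewrite ltn_eqF.
split=> /=; first by lia.
- by [].
- move=> k kl; case: (leqP k (pos p)) => [kp|pk].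
    have [|h1 h2] := at_P k; first by lia.
    by rewrite (ltn_eqF h1) h2 kp; split=> //; lia.
  case: (eqVneq k (pos p).+1) => [->|ne]; first by rewrite eqxx.
  have [|h1 h2] := at_P k.-1; first by lia.
  by rewrite (ltn_eqF h1) h2; split; [lia|rewrite ifN; lia].
- move=> k kl; rewrite ndp.
  case: (leqP k (pos p)) => [kp|pk].
    rewrite at_inj ?at_m; [|lia..].
    have -> : k.+1 < len.+1 by lia.
    case: (eqVneq k (pos p)) => [->|ne].
      by rewrite ltnn eqxx.
    have kp' : k < pos p by lia.
    rewrite kp' nx; last by lia.
    by rewrite ifT //; lia.
  have -> : (k.+1 <= pos p) = false by lia.
  have -> : (k.+1 == (pos p).+1) = false by lia.
  case: (eqVneq k (pos p).+1) => [->|ne].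
    rewrite eq_sym at_m // eqxx nx //.
  rewrite at_inj ?at_m; [|lia..].
  have -> : (k.-1 == pos p) = false by lia.
  rewrite nx; last by lia.
  by rewrite prednK //; lia.
- move=> u um; case: eqP => [_|/eqP ne]; first by lia.
  by have := ps u (ltm _ um ne); case: ifP; lia.
- move=> u um; case: eqP => [_|/eqP ne]; first by rewrite ltnn eqxx.
  rewrite nd ?ltm //; case: (leqP (pos u) (pos p)) => [-> //|lt].
  by rewrite ifN; [rewrite ifN //; lia|lia].
move=> u w um wm; case: (eqVneq u m) => [->|nu]; case: (eqVneq w m) => [->|nw] nr.
- by rewrite leqnn lexx.
- have {}nr : near_cols x w m by move: nr; rewrite /near_cols andbC.
  have wm' := ltm _ wm nw; have h1 := hw w wm' nr.
  have h2 := od w p wm' pm (near_p w wm' nr).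
  rewrite -h2 in h1; have h3 : (pos w <= pos p) -> (height x w < height x m)%R.
    by move=> le; rewrite h2 in le; lra.
  case: (leqP (pos w) (pos p)) h1 h3 => le h1 h3.
    by rewrite leNgt h3 //= ltnNge le.
  by rewrite ltnS (ltnW le) ltW // ltNge h1.
- have um' := ltm _ um nu; rewrite (hw u um' nr) -(od u p um' pm (near_p u um' nr)).
  by case: (leqP (pos u) (pos p)); lia.
- by rewrite -od ?ltm //; case: (leqP (pos u) (pos p)); case: (leqP (pos w) (pos p)); lia.
Qed.

End Linked.

(** * Numbering of the rows and output *)

Definition number_init : cmd :=
  Seq (NSet 9 (NConst 0) (NConst 0))
  (Seq (NSet 9 (NConst 1) (NConst 1)) (NSet 12 (NConst 0) (NConst 1))).

Definition number_guard : bexp := BNot (BNeq (NCell 11 (reg 0)) (NConst 0)).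

Definition number_body : cmd :=
  Seq (NSet 9 (NConst 0) (NCell 11 (reg 0)))
  (Seq (NSet 9 (NConst 1) (NSucc (reg 1))) (NSet 12 (reg 0) (reg 1))).

Definition output_init : cmd := NSet 9 (NConst 0) (NConst 0).

Definition output_guard : bexp := BNlt (reg 0) (NCell 0 (NConst 0)).

(** Each interval overwrites the number of rows of its column: heights do not decrease along a
    column, so the last value written is the largest. *)
Definition output_body : cmd :=
  Seq (NSet 5 (reg 0) (NCell 12 (NCell 10 (reg 0))))
  (Seq (NSet 4 (NCell 6 (reg 0)) (NCell 5 (reg 0)))
  (Seq (NSet 7 (reg 0) (NCell 1 (reg 0)))
  (Seq (NSet 8 (reg 0) (NCell 2 (reg 0)))
       (NSet 9 (NConst 0) (NSucc (reg 0)))))).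

Definition bubble_prog : cmd :=
  Seq init_prog (Seq (While insert_guard insert_body)
  (Seq number_init (Seq (While number_guard number_body)
  (Seq output_init (While output_guard output_body))))).

(** * Correctness and running time *)

Section Correctness.
Variables (R : realType) (n : nat) (x : nat -> R).
Hypothesis n_gt0 : 0 < n.
Hypothesis x_sorted : forall i j, i <= j -> j < n -> (x i <= x j)%R.

Definition frame (arrays : seq nat) (s s' : state R) : Prop :=
  forall a i, a \notin arrays -> nmem s' a i = nmem s a i.

Lemma upd_other (T : Type) (m : nat -> nat -> T) a i v a' i' :
  a' != a -> upd m a i v a' i' = m a' i'.
Proof. by rewrite /upd => /negbTE ->. Qed.

Variable s0 : state R.
Hypothesis s0_size : nmem s0 0 0 = n.
Hypothesis s0_zero : forall a i, 2 < a -> nmem s0 a i = 0.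
Hypothesis s0_x : forall i, rmem s0 0 i = x i.

(** [inv_pred] tells whether the latest event was a right end or a left end, in the form that
    [height_predP] expects; [inv_after] yields its first case at the next advance. [inv_before] is
    guarded because [x] is only known to be sorted below [n]. *)
Record insert_inv (s : state R) : Prop := InsertInv {
  inv_frame : frame [:: 3; 6; 9; 10; 11] s0 s;
  inv_x : forall i, rmem s 0 i = x i;
  inv_m : 0 < nmem s 9 0 <= n;
  inv_a : nmem s 9 1 <= nmem s 9 0;
  inv_p : nmem s 9 2 < nmem s 9 0;
  inv_before : nmem s 9 0 < n ->
    forall w, w < nmem s 9 1 -> (x w + 1 <= x (nmem s 9 0))%R;
  inv_after : (x (nmem s 9 0).-1 < x (nmem s 9 1) + 1)%R;
  inv_pred :
    ((nmem s 9 2).+1 = nmem s 9 1 /\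
       (x (nmem s 9 0).-1 < x (nmem s 9 2) + 1)%R) \/
    (nmem s 9 2 = (nmem s 9 0).-1 /\
       forall w, w < nmem s 9 1 -> (x w + 1 <= x (nmem s 9 0).-1)%R);
  inv_cols : nmem s 3 0 = column x (nmem s 9 0).-1;
  inv_start : rmem s 1 0 = x (col_start x (nmem s 9 0).-1);
  inv_col : forall u, u < nmem s 9 0 -> nmem s 6 u = column x u;
  inv_linked : exists len pos at_,
    linked x (nmem s 9 0) len pos at_ (nmem s 10) (nmem s 11)
}.

Lemma init_inv : insert_inv (run init_prog s0).
Proof.
have z a i : 2 < a -> nmem s0 a i = 0 by exact: s0_zero.
split; first by move=> a i; rewrite !inE !negb_or => /and5P[a3 a6 a9 _ _];
  rewrite /= !upd_other.
all: rewrite /= /upd /= ?z //.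
- by lra.
- by right.
- by case=> //.
exists 1, (fun=> 0), (fun=> 0).
by apply: linked_ext (linked1 x) _ _ => u //=; rewrite z.
Qed.

Lemma run_column s : insert_inv s -> nmem s 9 0 < n ->
  let s' := run column_prog s in
  [/\ frame [:: 3; 6] s s', (forall i, rmem s' 0 i = x i),
      rmem s' 1 0 = x (col_start x (nmem s 9 0)),
      nmem s' 3 0 = column x (nmem s 9 0) &
      forall u, u <= nmem s 9 0 -> nmem s' 6 u = column x u].
Proof.
move=> inv mn; have [_ xE /andP[m0 _] _ _ _ _ _ kE cE colE _] := inv.
case mE: (nmem s 9 0) m0 kE cE colE => [//|m'] _ kE cE colE.
rewrite [_.+1.-1]/= in kE cE; rewrite /= mE xE cE.
case: ifP => lt; split=> //=.
- by move=> a i; rewrite !inE negb_or => /andP[a3 a6]; rewrite /= !upd_other.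
- by rewrite ?mE /upd /= ?mE => u um;
  case: eqP => [->|ne]; [rewrite /= lt|apply: colE; lia].
- by move=> a i; rewrite !inE negb_or => /andP[a3 a6]; rewrite /= !upd_other.
- by rewrite /upd /= kE.
- by rewrite ?mE /upd /= ?mE => u um;
  case: eqP => [->|ne]; [rewrite /= lt kE|apply: colE; lia].
Qed.

Lemma run_link s len pos at_ :
  let m := nmem s 9 0 in let p := nmem s 9 2 in
  (forall i, rmem s 0 i = x i) -> m < n -> height_pred x m p ->
  linked x m len pos at_ (nmem s 10) (nmem s 11) ->
  let s' := run link_prog s in
  [/\ frame [:: 10; 11] s s', rmem s' = rmem s &
      exists len pos at_,
        linked x m.+1 len pos at_ (nmem s' 10) (nmem s' 11)].
Proof.
move=> m p xE mn pred lk /=; rewrite !xE -!/m -!/p.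
have [pm cpm hpm _] := pred.
have pn := ltn_trans pm mn.
(* In each of the two possible columns of [p], one of the two equations tested cannot hold and the
   other says that the heights agree. *)
have same : ~~ ((x p != x m) && (x p + 1 != x m))%R =
            (height x p == height x m)%R.
  rewrite negb_and !negbK /height; case: cpm => cE.
    have := same_col_close x_sorted pn mn (esym cE); rewrite cE => lt.
    have -> : (x p + 1 == x m)%R = false by apply/negP => /eqP; lra.
    by rewrite orbF; apply/eqP/eqP; lra.
  have := col_lt x_sorted pn mn; rewrite cE leqnn => /(_ isT) lt.
  have -> : (x p == x m)%R = false by apply/negP => /eqP; lra.
  by rewrite -natr1 /=; apply/eqP/eqP; lra.
rewrite same; case: eqP => [E|/eqP ne] /=; split=> //.
- by move=> a i; rewrite !inE negb_or => /andP[a10 _]; rewrite /= upd_other.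
- do 3 eexists.
  by apply: linked_ext (linked_share lk pred E) _ _ => u; rewrite /upd.
- by move=> a i; rewrite !inE negb_or => /andP[a10 a11]; rewrite /= !upd_other.
do 3 eexists.
apply: linked_ext (linked_insert lk pred _) _ _ => [|u um|u].
- by rewrite lt_neqAle ne.
- by rewrite /upd /=.
- by rewrite /upd /=.
Qed.

Lemma insert_process s : insert_inv s -> nmem s 9 0 < n ->
  (x (nmem s 9 0) < x (nmem s 9 1) + 1)%R ->
  let s' := run (Seq column_prog (Seq link_prog next_prog)) s in
  [/\ insert_inv s', nmem s' 9 0 = (nmem s 9 0).+1 & nmem s' 9 1 = nmem s 9 1].
Proof.
move=> inv mn lt.
have [fr1 x1 st1 k1 c1] := run_column inv mn.
have [fr xE m0n am pm before after pred kE cE colE [len [pos [at_ lk]]]] := inv.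
set s1 := run column_prog s in fr1 x1 st1 k1 c1.
have reg1 k : nmem s1 9 k = nmem s 9 k by apply: fr1.
have pr : height_pred x (nmem s 9 0) (nmem s 9 2).
  by apply: (@height_predP R n x x_sorted _ (nmem s 9 1)) => //; [lia|exact: before].
have [] := @run_link s1 len pos at_ _ _ _ _; rewrite ?reg1 //.
  by apply: linked_ext lk _ _ => u *; apply: fr1.
set s2 := run link_prog s1 => fr2 r2 lk2.
have reg2 k : nmem s2 9 k = nmem s 9 k by rewrite fr2.
have -> : run (Seq column_prog (Seq link_prog next_prog)) s = run next_prog s2 by [].
clearbody s2; clearbody s1; split; [|by rewrite /= /upd /= ?reg2..].
split.
  move=> a i H; have /and5P[a3 a6 a9 a10 a11] :
      [&& a != 3, a != 6, a != 9, a != 10 & a != 11].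
    by move: H; rewrite !inE !negb_or.
  rewrite /= !upd_other // fr2 ?inE ?negb_or ?a10 ?a11 //.
  by rewrite fr1 ?inE ?negb_or ?a3 ?a6 //; apply: fr.
all: rewrite /= /upd /= ?reg2 ?r2 ?x1 //.
- by lia.
- by move=> m1n w wa; apply: le_trans (before mn w wa) _; apply: x_sorted.
- by right; split=> //; exact: before.
- by rewrite fr2.
- by move=> u um; rewrite fr2 // c1.
Qed.

Lemma insert_advance s : insert_inv s -> nmem s 9 0 < n ->
  (x (nmem s 9 1) + 1 <= x (nmem s 9 0))%R ->
  insert_inv (run advance_prog s) /\ nmem s 9 1 < nmem s 9 0.
Proof.
move=> inv mn le.
have [fr xE m0n am pm before after pred kE cE colE lk] := inv.
have am' : nmem s 9 1 < nmem s 9 0.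
  by rewrite ltn_neqAle am andbT; apply/eqP => E; rewrite E in le; lra.
split=> //; split.
  move=> a i H; have a9 : a != 9 by apply: contraNneq H => ->.
  by rewrite /= !upd_other ?fr.
all: rewrite /= /upd //=.
- move=> _ w; rewrite ltnS leq_eqVlt => /predU1P[-> //|]; exact: before.
- have := @x_sorted (nmem s 9 1) (nmem s 9 1).+1 (leqnSn _) (leq_ltn_trans am' mn).
  lra.
- by left.
Qed.

(** Every pass increases exactly one of the two counters, [i] and [a], and neither exceeds [n]; this
    is the amortized linear bound. *)
Lemma insert_loop : exists t s,
  [/\ exec (While insert_guard insert_body) (run init_prog s0) t s,
      insert_inv s, nmem s 9 0 = n &
      t <= (2 * n).+1 * csize (While insert_guard insert_body)].
Proof.
pose mu (s : state R) := (n - nmem s 9 0) + (n - nmem s 9 1).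
have [|t [s [ex inv nb le]]] :=
    @exec_while R insert_inv mu insert_guard insert_body _ isT _ init_inv.
  move=> s inv; have [fr xE m0n am pm _ _ _ _ _ _ _] := inv.
  rewrite [beval _ _]/= (fr 0 0) // s0_size => mn.
  have -> : run insert_body s = if (x (nmem s 9 0) < x (nmem s 9 1) + 1)%R
      then run (Seq column_prog (Seq link_prog next_prog)) s
      else run advance_prog s by rewrite -!xE.
  case: ifP => lt.
    have [inv' E1 E2] := insert_process inv mn lt.
    by split=> //; rewrite /mu E1 E2; lia.
  have [|inv' am'] := insert_advance inv mn; first by rewrite leNgt lt.
  by split=> //; rewrite /mu /= /upd /=; lia.
have [fr _ /andP[m0 mn] _ _ _ _ _ _ _ _ _] := inv.
exists t, s; split=> //.
  by apply/eqP; rewrite eqn_leq mn leqNgt; move: nb; rewrite /= (fr 0 0) // s0_size.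
apply: leq_trans le _; rewrite leq_mul2r ltnS; apply/orP; right.
by rewrite /mu; lia.
Qed.

Lemma number_loop s len pos at_ :
  linked x n len pos at_ (nmem s 10) (nmem s 11) ->
  exists t s',
  [/\ exec (While number_guard number_body) (run number_init s) t s',
      frame [:: 9; 12] s s',
      forall k, k < len -> nmem s' 12 (at_ k) = k.+1 &
      t <= n.+1 * csize (While number_guard number_body)].
Proof.
move=> lk; have /andP[len0 len_n] := linked_len lk.
pose Inv (s' : state R) := frame [:: 9; 12] s s' /\ exists k,
  [/\ k < len, nmem s' 9 0 = at_ k, nmem s' 9 1 = k.+1 &
      forall k', k' <= k -> nmem s' 12 (at_ k') = k'.+1].
pose mu (s' : state R) := len - nmem s' 9 1.
have inv0 : Inv (run number_init s).
  split.
    move=> a i; rewrite !inE negb_or => /andP[a9 a12].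
    by rewrite /= !upd_other.
  exists 0; rewrite /= /upd /= (linked_head lk); split=> // k'.
  by rewrite leqn0 => /eqP ->; rewrite (linked_head lk).
have [|t [s' [ex [fr [k [kl pE rE rows]]] nb le]]] :=
    @exec_while R Inv mu number_guard number_body _ isT _ inv0.
  move=> s' [fr [k [kl pE rE rows]]].
  rewrite [beval _ _]/= pE fr // (linked_next lk kl).
  case: ifP => // kl1 _; split; last first.
    by rewrite /mu /= /upd /= rE; lia.
  split.
    move=> a i H; have := H; rewrite !inE negb_or => /andP[a9 a12].
    by rewrite /= !upd_other ?fr.
  exists k.+1; rewrite /= /upd /= pE rE fr // (linked_next lk kl) kl1.
  split=> // k' kk.
  have -> : (at_ k' == at_ k.+1) = (k' == k.+1).
    apply/eqP/eqP => [h|-> //].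
    have [_ <-] := linked_at lk (leq_ltn_trans kk kl1).
    by rewrite h; have [_ ->] := linked_at lk kl1.
  by case: eqP => [-> //|ne]; apply: rows; lia.
(* The guard can only fail at the end of the list, since a successor is never cell 0. *)
have klast : k.+1 = len.
  move: nb; rewrite /= negbK pE fr // (linked_next lk kl).
  case: ifP => [kl1|]; last by lia.
  by rewrite (linked_at_eq0 lk kl1).
exists t, s'; split=> // [k' kl'|]; first by apply: rows; lia.
apply: leq_trans le _; rewrite leq_mul2r ltnS; apply/orP; right.
by rewrite /mu; lia.
Qed.

Lemma output_loop s len pos at_ :
  nmem s 0 0 = n -> (forall u, u < n -> nmem s 6 u = column x u) ->
  linked x n len pos at_ (nmem s 10) (nmem s 11) ->
  (forall k, k < len -> nmem s 12 (at_ k) = k.+1) ->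
  exists t s',
  [/\ exec (While output_guard output_body) (run output_init s) t s',
      frame [:: 4; 5; 7; 8; 9] s s',
      forall u, u < n -> [/\ nmem s' 5 u = (pos u).+1,
        nmem s' 7 u = nmem s 1 u & nmem s' 8 u = nmem s 2 u],
      forall u, u < n -> pos u < nmem s' 4 (column x u) /\
        exists w, [/\ w < n, column x w = column x u &
                      nmem s' 4 (column x u) = (pos w).+1] &
      t <= n.+1 * csize (While output_guard output_body)].
Proof.
move=> sz colE lk rowE.
pose Inv (s' : state R) := [/\ frame [:: 4; 5; 7; 8; 9] s s',
  nmem s' 9 0 <= n,
  forall u, u < nmem s' 9 0 -> [/\ nmem s' 5 u = (pos u).+1,
        nmem s' 7 u = nmem s 1 u & nmem s' 8 u = nmem s 2 u] &
  forall u, u < nmem s' 9 0 -> pos u < nmem s' 4 (column x u) /\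
        exists w, [/\ w < nmem s' 9 0, column x w = column x u &
                      nmem s' 4 (column x u) = (pos w).+1]].
pose mu (s' : state R) := n - nmem s' 9 0.
have inv0 : Inv (run output_init s).
  split=> //= a i; rewrite !inE !negb_or => /and5P[_ _ _ _ a9].
  by rewrite /= upd_other.
have [|t [s' [ex [fr le_n out last] nb le]]] :=
    @exec_while R Inv mu output_guard output_body _ isT _ inv0.
  move=> s' [fr le_n out last].
  rewrite [beval _ _]/= (fr 0) // sz => mn; split; last first.
    by rewrite /mu /= /upd /=; lia.
  have rowm : nmem s' 12 (nmem s' 10 (nmem s' 9 0)) = (pos (nmem s' 9 0)).+1.
    by rewrite (fr 12) // (fr 10) // (linked_node lk mn) rowE // (linked_pos lk mn).
  have colm : nmem s' 6 (nmem s' 9 0) = column x (nmem s' 9 0).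
    by rewrite (fr 6) ?colE.
  split.
  - move=> a i H; have /and5P[a4 a5 a7 a8 a9] :
        [&& a != 4, a != 5, a != 7, a != 8 & a != 9].
      by move: H; rewrite !inE !negb_or.
    by rewrite /= !upd_other ?fr.
  - by rewrite /= /upd /=.
  - move=> u; rewrite /= /upd /= ltnS rowm => um.
    case: eqP => [->|ne]; first by rewrite (fr 1) ?(fr 2).
    by apply: out; lia.
  move=> u; rewrite /= /upd /= ltnS rowm colm !eqxx => um.
  have [cE|cne] := eqVneq (column x u) (column x (nmem s' 9 0)).
    split; last by exists (nmem s' 9 0).
    have un := leq_ltn_trans um mn.
    rewrite ltnS (linked_order lk) //; last by rewrite /near_cols cE leqnSn.
    by rewrite /height cE lerB ?x_sorted.
  have um' : u < nmem s' 9 0.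
    by rewrite ltn_neqAle um andbT; apply: contraNneq cne => ->.
  have [le_u [w [wm wc wE]]] := last u um'; split=> //.
  by exists w; split=> //; exact: ltnW.
have mE : nmem s' 9 0 = n.
  by apply/eqP; rewrite eqn_leq le_n leqNgt; move: nb; rewrite /= (fr 0) // sz.
rewrite mE in out last; exists t, s'; split=> //.
apply: leq_trans le _; rewrite leq_mul2r ltnS; apply/orP; right.
by rewrite /mu leq_subr.
Qed.

Lemma bubble_prog_correct : exists t s pos,
  [/\ exec bubble_prog s0 t s, t <= 3 * csize bubble_prog * n,
      nmem s 3 0 = column x n.-1,
      forall u, u < n -> [/\ nmem s 5 u = (pos u).+1, nmem s 6 u = column x u,
        nmem s 7 u = nmem s0 1 u & nmem s 8 u = nmem s0 2 u] &
      [/\ pos 0 = 0,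
        forall u w, u < n -> w < n -> near_cols x u w ->
          (pos u <= pos w) = (height x u <= height x w)%R,
        forall u k, u < n -> k <= pos u -> exists2 w, w < n & pos w = k &
        forall u, u < n -> pos u < nmem s 4 (column x u) /\
          exists w, [/\ w < n, column x w = column x u &
                        nmem s 4 (column x u) = (pos w).+1]]].
Proof.
have [t1 le1 ex1] := @exec_run R init_prog s0 isT.
have [t2 [s2 [ex2 inv mE le2]]] := insert_loop.
have [fr2 _ _ _ _ _ _ _ kE _ colE [len [pos [at_ lk]]]] := inv.
rewrite mE in kE colE lk.
have [t3 le3 ex3] := @exec_run R number_init s2 isT.
have [t4 [s4 [ex4 fr4 rowE le4]]] := number_loop lk.
have [t5 le5 ex5] := @exec_run R output_init s4 isT.
have [||||t6 [s6 [ex6 fr6 out last le6]]] := @output_loop s4 len pos at_.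
- by rewrite fr4 // fr2.
- by move=> u un; rewrite fr4 // colE.
- by apply: linked_ext lk _ _ => u *; rewrite fr4.
- exact: rowE.
exists (t1 + (t2 + (t3 + (t4 + (t5 + t6).+1).+1).+1).+1).+1, s6, pos; split.
- apply: exec_seq ex1 _; apply: exec_seq ex2 _; apply: exec_seq ex3 _.
  by apply: exec_seq ex4 _; apply: exec_seq ex5 ex6.
- have -> : csize bubble_prog = (csize init_prog +
      (csize (While insert_guard insert_body) + (csize number_init +
      (csize (While number_guard number_body) + (csize output_init +
      csize (While output_guard output_body)).+1).+1).+1).+1).+1 by [].
  move: le1 le2 le3 le4 le5 le6; move: (csize (While insert_guard _))
    (csize (While number_guard _)) (csize (While output_guard _)) => c2 c4 c6.
  move: (csize init_prog) (csize number_init) (csize output_init).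
  move=> c1 c3 c5 le1 le2 le3 le4 le5 le6.
  (* As [n] is positive, even the [(2 * n).+1] guard tests of the insertion loop are at most
     [3 * n], and so every summand is at most [3 * n] times its size. *)
  have up c : c <= 3 * n * c by rewrite leq_pmull // muln_gt0.
  have le2' : t2 <= 3 * n * c2 by apply: leq_trans le2 _; rewrite leq_mul2r; lia.
  have le4' : t4 <= 3 * n * c4 by apply: leq_trans le4 _; rewrite leq_mul2r; lia.
  have le6' : t6 <= 3 * n * c6 by apply: leq_trans le6 _; rewrite leq_mul2r; lia.
  rewrite mulnAC; have := up c1; have := up c3; have := up c5.
  have : 0 < 3 * n by lia.
  move: (3 * n) le2' le4' le6' => K *; lia.
- by rewrite fr6 // fr4.
- move=> u un; have [E5 E7 E8] := out u un; rewrite E5 E7 E8 fr6 // !fr4 //.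
  by rewrite colE ?(fr2 1) ?(fr2 2).
split=> //; first exact: linked_pos0 lk.
- exact: linked_order lk.
- move=> u k un le; have kl := leq_ltn_trans le (linked_pos lk un).
  by have [h1 h2] := linked_at lk kl; exists (at_ k).
Qed.

End Correctness.

(** * Models in linear time and the equivalence *)

Lemma bubble_prog_model (R : realType) (V : finType) (e : rel V) (x : V -> R)
    (q : V -> itype) (vs : seq V) :
  0 < #|V| -> simple_graph e -> mui_representation e x q ->
  left_endpoint_order x vs ->
  exists (t : nat) (s : state R) (B : bubble_structure V),
    [/\ exec bubble_prog (input_state vs x q) t s,
        t <= 3 * csize bubble_prog * #|V|, outputs vs s B & bubble_model e B].
Proof.
move=> V0 simple rep ord; have szE := order_size ord.
pose X i := nth 0%R [seq x v | v <- vs] i.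
have n0 : 0 < size vs by rewrite szE.
have [|t [s [pos [ex le kE out [pos0 posord possurj last]]]]] :=
    @bubble_prog_correct R (size vs) X n0 (order_sorted ord)
      (input_state vs x q) erefl _ (fun=> erefl).
  by case=> [|[|[|a]]].
(* Rows are list positions plus one, as positions count from 0. *)
have row_surj u i : u < size vs -> 0 < i <= (pos u).+1 ->
    exists2 w, w < size vs & (pos w).+1 = i.
  move=> un /andP[i0 iu]; have [|w wn wE] := possurj u i.-1 un; first by lia.
  by exists w => //; rewrite wE prednK.
exists t, s, (@order_bubbles R V x q vs V0 ord (fun u => (pos u).+1) (nmem s 4)
  (fun _ _ => isT) last); split=> //.
- by rewrite -szE.
- split=> //= v i j p _.
  rewrite inE => /and3P[/eqP <- /eqP <- /eqP <-].
  have vn := order_index_lt ord v; have [-> -> -> ->] := out _ vn.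
  by rewrite /= !(nth_map v) // nth_index // (order_mem ord).
- by apply: order_bubbles_model; rewrite ?pos0.
Qed.

Theorem theorem2 (R : realType) :
  (forall (V : finType) (e : rel V), 0 < #|V| -> simple_graph e ->
     (mixed_unit_interval_graph R e <->
      exists B : bubble_structure V, bubble_model e B)) /\
  (exists (p : cmd) (c : nat),
     forall (V : finType) (e : rel V) (x : V -> R) (q : V -> itype)
            (vs : seq V),
       0 < #|V| -> simple_graph e -> mui_representation e x q ->
       left_endpoint_order x vs ->
       exists (t : nat) (s : state R) (B : bubble_structure V),
         [/\ exec p (input_state vs x q) t s, t <= c * #|V|,
             outputs vs s B & bubble_model e B]).
Proof.
split.
  move=> V e V0 simple; split=> [[x [q rep]]|[B /bubble_model_mixed_unit_interval]].
    (* For mere existence the intervals are sorted outside the program, whose output is then a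
       model. *)
    pose vs := sort (fun u v => (x u <= x v)%R) (enum V).
    have ord : left_endpoint_order x vs.
      split; first by rewrite perm_sort.
      by apply: sort_sorted => u v; exact: le_total.
    have [t [s [B [_ _ _ model]]]] := bubble_prog_model V0 simple rep ord.
    by exists B.
  exact.
exists bubble_prog, (3 * csize bubble_prog) => V e x q vs.
exact: bubble_prog_model.
Qed.
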